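(* Let $\Gamma$ be a groupoid, let $R=\bigoplus_{\gamma\in\Gamma}R_\gamma$ be a $\Gamma$-graded pfm ring and let $M=\bigoplus_{\gamma\in\Gamma}M_\gamma$ be a $\Gamma$-graded $R$-module. The following assertions hold: (1) $M$ has a gr-simple pseudo-basis. (2) Any two gr-simple pseudo-bases of $M$ have the same cardinality $\operatorname{sdim}_R(M)$. (3) Every pseudo-linearly independent gr-simple sequence of $M$ extends to a gr-simple pseudo-basis of $M$. (4) If $N$ is a graded submodule of $M$, then $\operatorname{spdim}_R(N)+\operatorname{spdim}_R(M/N)=\operatorname{spdim}_R(M)$.
   Context: A groupoid $\Gamma$ is a small category with all morphisms invertible, identified with its set of morphisms; $\Gamma_0$ is its set of objects (identified with identity morphisms). For $\gamma:e\to f$ write $d(\gamma)=e$, $r(\gamma)=f$; $\delta\gamma$ is defined iff $d(\delta)=r(\gamma)$. A $\Gamma$-graded ring is an associative ring $R=\bigoplus_{\gamma\in\Gamma}R_\gamma$ (additive subgroups) with $R_\gamma R_\delta\subseteq R_{\gamma\delta}$ if $\gamma\delta$ is defined and $R_\gamma R_\delta=0$ otherwise, always assumed object unital: for each $e\in\Gamma_0$, $R_e$ is a unital ring with identity $1_e$ (possibly $1_e=0$) and $1_{r(\gamma)}a=a=a1_{d(\gamma)}$ for $a\in R_\gamma$. A $\Gamma$-graded $R$-module is a right $R$-module $M=\bigoplus_\gamma M_\gamma$ with $M_\gamma R_\delta\subseteq M_{\gamma\delta}$ (zero if undefined) and $MR=M$. A graded module is gr-simple if nonzero with only graded submodules $0$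 and itself, and gr-semisimple if it is a sum of gr-simple graded submodules. A sequence of (nonzero) homogeneous elements $x_i\in M_{\gamma_i}$ $(i\in I)$ is pseudo-linearly independent if the only $(a_i)\in\bigoplus_i1_{d(\gamma_i)}R$ with $\sum x_ia_i=0$ is $(a_i)=0$; it is a pseudo-basis of $M$ if moreover it generates $M$. $M$ is pseudo-free if it has a pseudo-basis. $R$ is a pfm (pseudo-free module) ring if every $\Gamma$-graded right $R$-module is pseudo-free; then every graded $R$-module is gr-semisimple. If $M$ is gr-semisimple and $M=\bigoplus_{i\in I}M_i$ with each $M_i$ a gr-simple graded submodule, then $|I|$ does not depend on the decomposition, and $\operatorname{sdim}_R(M):=|I|$. A pseudo-linearly independent sequence $(x_i)_{i\in I}$ of homogeneous elements of $M$ is a gr-simple sequence if $x_iR$ is a gr-simple $R$-module for all $i\in I$. If it is moreover a pseudo-basis of $M$, it is a gr-simple pseudo-basis of $M$, and then $\operatorname{spdim}_R(M):=|I|$. *)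

(* Defs.v *)
From HB Require Import structures.
From mathcomp Require Import all_boot all_order all_algebra.
From mathcomp Require Import finmap.
From mathcomp Require Import all_classical.

Set Implicit Arguments.
Unset Strict Implicit.
Unset Printing Implicit Defensive.

Import GRing.Theory.

Local Open Scope classical_set_scope.
Local Open Scope ring_scope.

(** Classical logic is used throughout.  The index types of families (and the
    carriers of groupoids) are choiceTypes only because finitely supported sums
    [\sum_(i \in setT) f i] require it; classically every type is one. *)

Definition fin_supp (I : Type) (V : zmodType) (f : I -> V) : Prop :=
  finite_set (f @^-1` [set~ 0]).

Definition internal_direct_sum (V : zmodType) (I : choiceType)
    (D : set V) (W : I -> set V) : Prop :=
  [/\ forall i, W i `<=` D,
      forall x, D x -> exists f : I -> V,
        [/\ fin_supp f, forall i, W i (f i) & x = \sum_(i \in setT) f i] &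
      forall f : I -> V, fin_supp f -> (forall i, W i (f i)) ->
        \sum_(i \in setT) f i = 0 -> forall i, f i = 0].

(** [gcomp d c] is the composite "d after c".  It is a total function, but no
    axiom constrains it unless [gdom d = gcod c]. *)
Record groupoid := Groupoid {
  gobj : Type;
  gmor :> choiceType;
  gdom : gmor -> gobj;
  gcod : gmor -> gobj;
  gid : gobj -> gmor;
  gcomp : gmor -> gmor -> gmor;
  ginv : gmor -> gmor;
  gdom_id : forall e, gdom (gid e) = e;
  gcod_id : forall e, gcod (gid e) = e;
  gdom_comp : forall d c, gdom d = gcod c -> gdom (gcomp d c) = gdom c;
  gcod_comp : forall d c, gdom d = gcod c -> gcod (gcomp d c) = gcod d;
  gcompA : forall a b c, gdom a = gcod b -> gdom b = gcod c ->
    gcomp a (gcomp b c) = gcomp (gcomp a b) c;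
  gcomp_idl : forall c, gcomp (gid (gcod c)) c = c;
  gcomp_idr : forall c, gcomp c (gid (gdom c)) = c;
  gdom_inv : forall c, gdom (ginv c) = gcod c;
  gcod_inv : forall c, gcod (ginv c) = gdom c;
  gcomp_invl : forall c, gcomp (ginv c) c = gid (gdom c);
  gcomp_invr : forall c, gcomp c (ginv c) = gid (gcod c)
}.

(** Object unital graded rings; the ring need not have an identity element,
    which is why [nzRingType] or [pzRingType] cannot be used. *)
Record grRing (G : groupoid) := GrRing {
  gr_sort :> zmodType;
  gr_mul : gr_sort -> gr_sort -> gr_sort;
  gr_comp : G -> set gr_sort;
  gr_one : gobj G -> gr_sort;
  gr_mulA : associative gr_mul;
  gr_mulDl : left_distributive gr_mul +%R;
  gr_mulDr : right_distributive gr_mul +%R;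
  gr_comp_zmod : forall c, zmod_closed [in gr_comp c];
  gr_comp_sum : internal_direct_sum setT gr_comp;
  gr_comp_mul : forall c d a b, gdom c = gcod d ->
    gr_comp c a -> gr_comp d b -> gr_comp (gcomp c d) (gr_mul a b);
  gr_comp_mul0 : forall c d a b, gdom c <> gcod d ->
    gr_comp c a -> gr_comp d b -> gr_mul a b = 0;
  gr_one_comp : forall e, gr_comp (gid e) (gr_one e);
  gr_mul1l : forall c a, gr_comp c a -> gr_mul (gr_one (gcod c)) a = a;
  gr_mul1r : forall c a, gr_comp c a -> gr_mul a (gr_one (gdom c)) = a
}.

(** Graded right modules; the last axiom is [M R = M]. *)
Record grModule (G : groupoid) (R : grRing G) := GrModule {
  gm_sort :> zmodType;
  gm_act : gm_sort -> R -> gm_sort;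
  gm_comp : G -> set gm_sort;
  gm_actA : forall x a b, gm_act (gm_act x a) b = gm_act x (gr_mul a b);
  gm_actDl : forall x y a, gm_act (x + y) a = gm_act x a + gm_act y a;
  gm_actDr : forall x a b, gm_act x (a + b) = gm_act x a + gm_act x b;
  gm_comp_zmod : forall c, zmod_closed [in gm_comp c];
  gm_comp_sum : internal_direct_sum setT gm_comp;
  gm_comp_act : forall c d x a, gdom c = gcod d ->
    gm_comp c x -> gr_comp d a -> gm_comp (gcomp c d) (gm_act x a);
  gm_comp_act0 : forall c d x a, gdom c <> gcod d ->
    gm_comp c x -> gr_comp d a -> gm_act x a = 0;
  gm_full : forall x, exists n (y : 'I_n -> gm_sort) (a : 'I_n -> R),
    x = \sum_(i < n) gm_act (y i) (a i)
}.

Section Notions.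
Variables (G : groupoid) (R : grRing G).

Definition graded_submodule (M : grModule R) (N : set M) : Prop :=
  [/\ zmod_closed [in N],
      forall x a, N x -> N (gm_act x a) &
      internal_direct_sum N (fun c => N `&` gm_comp c)].

(** A graded submodule [S] of [M] that is gr-simple as a graded module: the
    graded submodules of [S] are those of [M] contained in [S]. *)
Definition gr_simple (M : grModule R) (S : set M) : Prop :=
  [/\ graded_submodule S,
      S <> [set 0] &
      forall T : set M, graded_submodule T -> T `<=` S ->
        T = [set 0] \/ T = S].

Definition cyclic_submodule (M : grModule R) (x : M) : set M :=
  range (gm_act x).

(** The submodule generated by the [x i], that is, the sum of the [x i R].
    It contains the [x i] when they are homogeneous, as then
    [x i = x i 1_(gdom c)]. *)
Definition span (M : grModule R) (I : choiceType) (x : I -> M) : set M :=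
  [set y | exists a : I -> R,
     fin_supp a /\ y = \sum_(i \in setT) gm_act (x i) (a i)].

(** The degrees [c i] are determined by [x], the [x i] being nonzero. *)
Definition pseudo_lin_indep (M : grModule R) (I : choiceType) (x : I -> M) :
    Prop :=
  exists c : I -> G,
    [/\ forall i, gm_comp (c i) (x i),
        forall i, x i <> 0 &
        forall a : I -> R, fin_supp a ->
          (forall i, range (gr_mul (gr_one R (gdom (c i)))) (a i)) ->
          \sum_(i \in setT) gm_act (x i) (a i) = 0 -> forall i, a i = 0].

Definition pseudo_basis (M : grModule R) (I : choiceType) (x : I -> M) : Prop :=
  pseudo_lin_indep x /\ span x = setT.

Definition pseudo_free (M : grModule R) : Prop :=
  exists (I : choiceType) (x : I -> M), pseudo_basis x.

Definition gr_simple_sequence (M : grModule R) (I : choiceType) (x : I -> M) :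
    Prop :=
  pseudo_lin_indep x /\ forall i, gr_simple (cyclic_submodule (x i)).

Definition gr_simple_pseudo_basis (M : grModule R) (I : choiceType)
    (x : I -> M) : Prop :=
  gr_simple_sequence x /\ pseudo_basis x.

Definition gr_simple_decomposition (M : grModule R) (I : choiceType)
    (S : I -> set M) : Prop :=
  (forall i, gr_simple (S i)) /\ internal_direct_sum setT S.

(** Cardinals are represented by types, to be compared with [#=].  [sdim M] and
    [spdim M] are the index types of a chosen decomposition, resp. basis; the
    value [void] is a junk value used when there is none. *)
Definition sdim (M : grModule R) : choiceType :=
  if pselect (exists I : choiceType, exists S : I -> set M,
                gr_simple_decomposition S) is left h
  then sval (cid h) else void.

Definition spdim (M : grModule R) : choiceType :=
  if pselect (exists I : choiceType, exists x : I -> M,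
                gr_simple_pseudo_basis x) is left h
  then sval (cid h) else void.

End Notions.

Definition pfm_ring (G : groupoid) (R : grRing G) : Prop :=
  forall M : grModule R, pseudo_free M.

Section FinSupp.
Variables (I : choiceType).

Lemma fin_supp_sub (V W : zmodType) (f : I -> V) (g : I -> W) :
  fin_supp f -> (forall i, f i = 0 -> g i = 0) -> fin_supp g.
Proof.
move=> ff fg; apply: sub_finite_set ff => i /= gi fi.
by apply: gi; apply: fg.
Qed.

Lemma fin_suppB (V : zmodType) (f g : I -> V) :
  fin_supp f -> fin_supp g -> fin_supp (fun i => f i - g i).
Proof.
move=> ff fg; apply: (@sub_finite_set _ _
  ((f @^-1` [set~ 0]) `|` (g @^-1` [set~ 0]))); last first.
  by rewrite finite_setU; split.
move=> i /= fgi; have [fi0|] := pselect (f i = 0); last by left.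
by right=> gi0; apply: fgi; rewrite fi0 gi0 subr0.
Qed.

Lemma fsum_morph (V W : zmodType) (h : V -> W) (f : I -> V) :
  h 0 = 0 -> {morph h : x y / x + y} -> fin_supp f ->
  h (\sum_(i \in setT) f i) = \sum_(i \in setT) h (f i).
Proof.
move=> h0 hD ff; set A := fset_set (f @^-1` [set~ 0]).
have fA i : i \notin A -> f i = 0.
  move=> iA; apply: contrapT => fi; case/negP: iA.
  by rewrite in_fset_set//; apply/mem_set.
have hfA i : i \notin A -> h (f i) = 0 by move=> /fA ->.
rewrite (@fsbigTE _ _ _ _ A f fA) (@fsbigTE _ _ _ _ A _ hfA).
exact: big_morph.
Qed.

Lemma fsumD (V : zmodType) (f g : I -> V) : fin_supp f -> fin_supp g ->
  \sum_(i \in setT) (f i + g i) =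
  \sum_(i \in setT) f i + \sum_(i \in setT) g i.
Proof.
move=> ff fg; set A := fset_set ((f @^-1` [set~ 0]) `|` (g @^-1` [set~ 0])).
have fgfin : finite_set ((f @^-1` [set~ 0]) `|` (g @^-1` [set~ 0])).
  by rewrite finite_setU; split.
have Af i : i \notin A -> f i = 0.
  rewrite in_fset_set // => /negP iA; apply: contrapT => fi.
  by apply: iA; apply/mem_set; left.
have Ag i : i \notin A -> g i = 0.
  rewrite in_fset_set // => /negP iA; apply: contrapT => gi.
  by apply: iA; apply/mem_set; right.
have Afg i : i \notin A -> f i + g i = 0.
  by move=> iA; rewrite Af // Ag // addr0.
rewrite (@fsbigTE _ _ _ _ A f Af) (@fsbigTE _ _ _ _ A g Ag).
by rewrite (@fsbigTE _ _ _ _ A _ Afg) big_split.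
Qed.

Lemma fsumB (V : zmodType) (f g : I -> V) : fin_supp f -> fin_supp g ->
  \sum_(i \in setT) (f i - g i) =
  \sum_(i \in setT) f i - \sum_(i \in setT) g i.
Proof.
move=> ff fg; have fNg : fin_supp (fun i => - g i).
  by apply: (fin_supp_sub fg) => i ->; rewrite oppr0.
rewrite (fsum_morph (h := -%R)) ?oppr0 //; last exact: opprD.
exact: fsumD.
Qed.

Lemma fin_supp_single (V : zmodType) (j : I) (x : V) :
  fin_supp (fun i => if i == j then x else 0).
Proof.
apply: (@sub_finite_set _ _ [set j]); last exact: finite_set1.
by move=> i /=; case: eqP.
Qed.

Lemma fsum_single (V : zmodType) (j : I) (x : V) :
  \sum_(i \in setT) (if i == j then x else 0) = x.
Proof.
have Hj i : i \notin [fset j]%fset -> (if i == j then x else 0) = 0.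
  by rewrite inE; case: eqP.
by rewrite (@fsbigTE _ _ _ _ _ _ Hj) big_seq_fset1 eqxx.
Qed.

Lemma internal_direct_sum_uniq (V : zmodType) (D : set V) (W : I -> set V)
    (f g : I -> V) :
  internal_direct_sum D W -> (forall i, zmod_closed [in W i]) ->
  fin_supp f -> fin_supp g ->
  (forall i, W i (f i)) -> (forall i, W i (g i)) ->
  \sum_(i \in setT) f i = \sum_(i \in setT) g i -> forall i, f i = g i.
Proof.
move=> [_ _ W0] Wz ff fg fW gW fg_eq i; apply/eqP; rewrite -subr_eq0; apply/eqP.
apply: (W0 (fun i => f i - g i)) => [|j|].
- exact: fin_suppB.
- case: (Wz j) => _ WB; apply: set_mem; apply: WB; exact/mem_set.
- by rewrite fsumB // fg_eq subrr.
Qed.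

End FinSupp.

Section ModuleFacts.
Variables (G : groupoid) (R : grRing G) (M : grModule R).

Lemma gm_act0l (a : R) : gm_act (0 : M) a = 0.
Proof. by apply: (addrI (gm_act (0 : M) a)); rewrite -gm_actDl !addr0. Qed.

Lemma gm_act0r (x : M) : gm_act x 0 = 0.
Proof. by apply: (addrI (gm_act x 0)); rewrite -gm_actDr !addr0. Qed.

Lemma gm_actBl (x y : M) a : gm_act (x - y) a = gm_act x a - gm_act y a.
Proof. by apply/eqP; rewrite eq_sym subr_eq -gm_actDl subrK. Qed.

(** Homogeneous elements are fixed by the local units; this follows from
    [M R = M]. *)
Let unitary (x : M) := exists f : G -> M,
  [/\ fin_supp f, forall c, gm_comp c (f c), x = \sum_(c \in setT) f c &
      forall c, gm_act (f c) (gr_one R (gdom c)) = f c].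

Let zmodP (c : G) := gm_comp_zmod M c.

Lemma gm_comp0 (c : G) : gm_comp c (0 : M).
Proof. by case: (zmodP c) => M0 _; apply: set_mem. Qed.

Lemma gm_compB (c : G) (x y : M) :
  gm_comp c x -> gm_comp c y -> gm_comp c (x - y).
Proof.
case: (zmodP c) => _ MB cx cy; apply: set_mem; apply: MB; exact/mem_set.
Qed.

Lemma gm_compD (c : G) (x y : M) :
  gm_comp c x -> gm_comp c y -> gm_comp c (x + y).
Proof.
move=> cx cy; rewrite -[y]opprK -[- y]sub0r; apply: gm_compB => //.
by apply: gm_compB => //; apply: gm_comp0.
Qed.

Let unitary_single (c : G) (x : M) : gm_comp c x ->
  gm_act x (gr_one R (gdom c)) = x -> unitary x.
Proof.
move=> cx x1; exists (fun i => if i == c then x else 0); split.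
- exact: fin_supp_single.
- by move=> i; case: eqP => [->|_] //; apply: gm_comp0.
- by rewrite fsum_single.
- by move=> i; case: eqP => [->|_] //; rewrite gm_act0l.
Qed.

Let unitary0 : unitary 0.
Proof.
exists (fun=> 0); split=> [|c||c].
- by apply: (@sub_finite_set _ _ set0) => // c; apply.
- exact: gm_comp0.
- by rewrite fsbig1.
- by rewrite gm_act0l.
Qed.

Let unitaryD x y : unitary x -> unitary y -> unitary (x + y).
Proof.
move=> [f [ff fc -> f1]] [g [gf gc -> g1]].
have gNf : fin_supp (fun c => - g c).
  by apply: (fin_supp_sub gf) => i ->; rewrite oppr0.
exists (fun c => f c + g c); split=> [|c||c].
- have := fin_suppB ff gNf; congr (fin_supp _).
  by apply/funext => c; rewrite opprK.
- exact: gm_compD.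
- by rewrite fsumD.
- by rewrite gm_actDl f1 g1.
Qed.

Let unitary_sum (I : Type) (r : seq I) (f : I -> M) :
  (forall i, unitary (f i)) -> unitary (\sum_(i <- r) f i).
Proof.
by move=> uf; elim/big_ind: _ => // x y; apply: unitaryD.
Qed.

Lemma gm_act1 (c : G) (x : M) :
  gm_comp c x -> gm_act x (gr_one R (gdom c)) = x.
Proof.
move=> cx; suff [f [ff fc xE f1]] : unitary x.
  suff <- : f c = x by exact: f1.
  have := internal_direct_sum_uniq (gm_comp_sum M) (gm_comp_zmod M) ff
    (fin_supp_single c x) fc.
  move=> /(_ _ _ c); rewrite eqxx; apply=> [i|]; last by rewrite fsum_single.
  by case: eqP => [->|_] //; apply: gm_comp0.
have [n [y [a ->]]] := gm_full x; apply: unitary_sum => i.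
have [_ /(_ (y i) I) [f [ff fc ->]] _] := gm_comp_sum M.
have [_ /(_ (a i) I) [g [gf gc ->]] _] := gr_comp_sum R.
rewrite (fsum_morph (h := fun z => gm_act z _)) ?gm_act0l //; last first.
  by move=> u v; rewrite gm_actDl.
apply: unitary_sum => j; rewrite (fsum_morph (h := gm_act (f j))) ?gm_act0r //;
  last exact: gm_actDr.
apply: unitary_sum => k.
have [jk|jk] := pselect (gdom j = gcod k); last first.
  by rewrite (gm_comp_act0 jk (fc j) (gc k)).
apply: (unitary_single (gm_comp_act jk (fc j) (gc k))).
by rewrite gm_actA gdom_comp // gr_mul1r.
Qed.

End ModuleFacts.

Record grSubmodule (G : groupoid) (R : grRing G) (M : grModule R) :=
  GrSubmodule {
    gs_set :> set M;
    gs_graded : graded_submodule gs_set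
  }.

Section SubAndQuotient.
Variables (G : groupoid) (R : grRing G) (M : grModule R).
Variable (N : grSubmodule M).

Definition gs_pred : {pred M} := [in (N : set M)].

Lemma gs_zmod : zmod_closed gs_pred.
Proof. by case: (gs_graded N). Qed.

HB.instance Definition _ := GRing.isZmodClosed.Build M gs_pred gs_zmod.

Lemma gs_predP (x : M) : x \in gs_pred -> (N : set M) x.
Proof. by move=> /set_mem. Qed.

Lemma gs_memP (x : M) : (N : set M) x -> x \in gs_pred.
Proof. by move=> Nx; apply/mem_set. Qed.

Lemma gs_act (x : M) a : x \in gs_pred -> gm_act x a \in gs_pred.
Proof.
by case: (gs_graded N) => _ H _ /gs_predP Nx; apply/gs_memP/H.
Qed.

Record sub_sort := SubSort { sub_val : M; sub_valP : sub_val \in gs_pred }.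

HB.instance Definition _ := [isSub for sub_val].
HB.instance Definition _ := [Choice of sub_sort by <:].
HB.instance Definition _ := [SubChoice_isSubZmodule of sub_sort by <:].

Lemma sub_val0 : sub_val 0 = 0. Proof. exact: (raddf0 val). Qed.

Lemma sub_valD : {morph sub_val : x y / x + y}.
Proof. exact: (raddfD val). Qed.

Lemma sub_valB : {morph sub_val : x y / x - y}.
Proof. exact: (raddfB val). Qed.

Definition sub_act (x : sub_sort) (a : R) : sub_sort :=
  SubSort (gs_act a (sub_valP x)).

Definition sub_comp (c : G) : set sub_sort := sub_val @^-1` (gm_comp c).

Lemma sub_actA x a b : sub_act (sub_act x a) b = sub_act x (gr_mul a b).
Proof. by apply: val_inj; rewrite /= gm_actA. Qed.

Lemma sub_actDl x y a : sub_act (x + y) a = sub_act x a + sub_act y a.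
Proof. apply: val_inj.
change (gm_act (sub_val (x + y)) a = sub_val (sub_act x a + sub_act y a)).
by rewrite !sub_valD gm_actDl. Qed.

Lemma sub_actDr x a b : sub_act x (a + b) = sub_act x a + sub_act x b.
Proof. apply: val_inj.
change (gm_act (sub_val x) (a + b) = sub_val (sub_act x a + sub_act x b)).
by rewrite !sub_valD gm_actDr. Qed.

Lemma sub_comp_zmod c : zmod_closed [in sub_comp c].
Proof.
case: (gm_comp_zmod M c) => M0 MB; split.
  apply/mem_set; change (gm_comp c (sub_val 0)).
  by rewrite sub_val0; apply: set_mem.
move=> x y /set_mem cx /set_mem cy; apply/mem_set.
change (gm_comp c (sub_val (x - y))); rewrite sub_valB.
by apply: set_mem; apply: MB; apply/mem_set.
Qed.

Lemma sub_comp_sum : internal_direct_sum setT sub_comp.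
Proof.
have [_ _ M0] := gm_comp_sum M.
case: (gs_graded N) => _ _ [_ Nsum _].
have vsum (f : G -> sub_sort) : fin_supp f ->
    sub_val (\sum_(i \in setT) f i) = \sum_(i \in setT) sub_val (f i).
  by move=> ff; apply: fsum_morph; [exact: sub_val0 | exact: sub_valD |].
split=> // [x _|f ff fc f0 i].
  have [f [ff fN xE]] := Nsum _ (gs_predP (sub_valP x)).
  have g_fs : fin_supp (fun i => SubSort (gs_memP (fN i).1)).
    by apply: (fin_supp_sub ff) => i fi; apply: val_inj.
  exists (fun i => SubSort (gs_memP (fN i).1)); split => // [i|].
    by case: (fN i).
  by apply: val_inj; rewrite /= vsum.
apply: val_inj => /=; apply: (M0 (sub_val \o f)) => //=.
  by apply: (fin_supp_sub ff) => j /= ->.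
by rewrite -vsum // f0.
Qed.

Lemma sub_comp_act c d x a : gdom c = gcod d ->
  sub_comp c x -> gr_comp d a -> sub_comp (gcomp c d) (sub_act x a).
Proof. exact: gm_comp_act. Qed.

Lemma sub_comp_act0 c d x a : gdom c <> gcod d ->
  sub_comp c x -> gr_comp d a -> sub_act x a = 0.
Proof.
by move=> cd cx da; apply: val_inj; rewrite /= (gm_comp_act0 cd cx da).
Qed.

Lemma sub_full x : exists n (y : 'I_n -> sub_sort) (a : 'I_n -> R),
  x = \sum_(i < n) sub_act (y i) (a i).
Proof.
have [_ /(_ x I) [f [_ fc ->]] _] := sub_comp_sum.
set r := finite_support _ _ _.
exists (size r), (fun i => f (tnth (in_tuple r) i)).
exists (fun i => gr_one R (gdom (tnth (in_tuple r) i))).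
rewrite big_tnth; apply: eq_bigr => i _; apply: val_inj => /=.
by rewrite gm_act1 //; apply: fc.
Qed.

Definition subGrModule : grModule R :=
  GrModule sub_actA sub_actDl sub_actDr sub_comp_zmod sub_comp_sum
    sub_comp_act sub_comp_act0 sub_full.

Local Open Scope quotient_scope.

Definition quo_sort : zmodType := Quotient.quot gs_pred.
Definition quo_pi (x : M) : quo_sort := \pi_(Quotient.quot gs_pred) x.

Lemma quo_piK (q : quo_sort) : quo_pi (repr q) = q.
Proof. exact: reprK. Qed.

Lemma quo_pi0 : quo_pi 0 = 0.
Proof. exact: pi_zeror. Qed.

Lemma quo_piD : {morph quo_pi : x y / x + y}.
Proof. exact: pi_addr. Qed.

Lemma quo_piB : {morph quo_pi : x y / x - y}.
Proof. by move=> x y; rewrite quo_piD; congr (_ + _); exact: pi_oppr. Qed.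

Lemma quo_pi_eq (x y : M) : quo_pi x = quo_pi y <-> (x - y) \in gs_pred.
Proof.
rewrite (Quotient.idealrBE gs_pred); split=> [h|/eqP//].
by apply/eqP.
Qed.

Definition quo_act (q : quo_sort) (a : R) : quo_sort :=
  quo_pi (gm_act (repr q) a).

Definition quo_comp (c : G) : set quo_sort := quo_pi @` gm_comp c.

Lemma quo_act_pi x a : quo_act (quo_pi x) a = quo_pi (gm_act x a).
Proof.
apply/quo_pi_eq; rewrite -gm_actBl; apply: gs_act.
by apply/quo_pi_eq; rewrite quo_piK.
Qed.

Lemma quo_actA x a b : quo_act (quo_act x a) b = quo_act x (gr_mul a b).
Proof. by rewrite -(quo_piK x) !quo_act_pi gm_actA. Qed.

Lemma quo_actDl x y a : quo_act (x + y) a = quo_act x a + quo_act y a.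
Proof.
by rewrite -(quo_piK x) -(quo_piK y) -quo_piD !quo_act_pi gm_actDl quo_piD.
Qed.

Lemma quo_actDr x a b : quo_act x (a + b) = quo_act x a + quo_act x b.
Proof. by rewrite -(quo_piK x) !quo_act_pi gm_actDr quo_piD. Qed.

Lemma quo_comp_zmod c : zmod_closed [in quo_comp c].
Proof.
split; first by apply/mem_set; exists 0; [exact: gm_comp0 | exact: quo_pi0].
move=> _ _ /set_mem [x cx <-] /set_mem [y cy <-]; apply/mem_set.
by exists (x - y); [exact: gm_compB | rewrite quo_piB].
Qed.

Lemma quo_comp_sum : internal_direct_sum setT quo_comp.
Proof.
have pisum (f : G -> M) : fin_supp f ->
    quo_pi (\sum_(i \in setT) f i) = \sum_(i \in setT) quo_pi (f i).
  by move=> ff; apply: fsum_morph; [exact: quo_pi0 | exact: quo_piD |].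
split=> // [x _|f ff fc f0 c].
  have [_ /(_ (repr x) I) [f [ff fc xE]] _] := gm_comp_sum M.
  exists (quo_pi \o f); split=> [|c|].
  - by apply: (fin_supp_sub ff) => c /= ->; rewrite quo_pi0.
  - by exists (f c).
  - by rewrite -pisum // -xE quo_piK.
have /choice [m mP] : forall c, exists x,
    [/\ gm_comp c x, quo_pi x = f c & f c = 0 -> x = 0].
  move=> d; have [fd0|fd0] := pselect (f d = 0).
    by exists 0; split=> //; [exact: gm_comp0 | rewrite quo_pi0].
  by have [x cx xE] := fc d; exists x.
have mf : fin_supp m by apply: (fin_supp_sub ff) => d; case: (mP d).
have mN : (N : set M) (\sum_(i \in setT) m i).
  apply: gs_predP; rewrite -[X in X \in _]subr0; apply/quo_pi_eq.
  rewrite pisum // quo_pi0 -[RHS]f0; apply: eq_fsbigr => d _.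
  by case: (mP d).
case: (gs_graded N) => _ _ [_ /(_ _ mN) [n [nf nN nE]] _].
have mn : m c = n c.
  apply: (internal_direct_sum_uniq (gm_comp_sum M) (gm_comp_zmod M)) => //.
  - by move=> d; case: (mP d).
  - by move=> d; case: (nN d).
case: (mP c) => _ <- _; rewrite -quo_pi0; apply/quo_pi_eq.
by rewrite subr0 mn; apply: gs_memP; case: (nN c).
Qed.

Lemma quo_comp_act c d x a : gdom c = gcod d ->
  quo_comp c x -> gr_comp d a -> quo_comp (gcomp c d) (quo_act x a).
Proof.
move=> cd [y cy <-] da; exists (gm_act y a); last by rewrite quo_act_pi.
exact: gm_comp_act.
Qed.

Lemma quo_comp_act0 c d x a : gdom c <> gcod d ->
  quo_comp c x -> gr_comp d a -> quo_act x a = 0.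
Proof.
by move=> cd [y cy <-] da; rewrite quo_act_pi (gm_comp_act0 cd cy da) quo_pi0.
Qed.

Lemma quo_full x : exists n (y : 'I_n -> quo_sort) (a : 'I_n -> R),
  x = \sum_(i < n) quo_act (y i) (a i).
Proof.
have [n [y [a xE]]] := gm_full (repr x).
exists n, (quo_pi \o y), a; rewrite -(quo_piK x) xE.
rewrite (big_morph quo_pi quo_piD quo_pi0).
by apply: eq_bigr => i _; rewrite quo_act_pi.
Qed.

Definition quoGrModule : grModule R :=
  GrModule quo_actA quo_actDl quo_actDr quo_comp_zmod quo_comp_sum
    quo_comp_act quo_comp_act0 quo_full.

End SubAndQuotient.

(* Main.v *)
Require Import Defs.
From mathcomp Require Import all_boot all_order all_algebra.
From mathcomp Require Import all_classical.

Set Implicit Arguments.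
Unset Strict Implicit.
Unset Printing Implicit Defensive.

Import GRing.Theory.

Local Open Scope classical_set_scope.
Local Open Scope card_scope.
Local Open Scope ring_scope.

(** Everything rests on one reduction. Call a nonzero homogeneous [x], of
    degree [c] with domain [e], pseudo-free if [a |-> x a] is injective on
    [1_e R]. Then [x R] is a shifted copy of [1_e R], so whether it is
    gr-simple depends on the object [e] alone: it says that every nonzero
    homogeneous element of [1_e R] has a right inverse (gr_simple_cyclicP). A
    gr-simple sequence is thus a family of pseudo-free elements with gr-simple
    objects whose cyclic submodules are independent (gr_simple_sequenceP), and
    such data moves freely between [M], its graded submodules and, by lifting
    homogeneous representatives, its graded quotients.

    Pseudo-freeness of all modules enters through quotients. If [q] is a
    pseudo-basis of [M / N] and [m] a homogeneous lift of it, then the span of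
    [m] is a complement of [N]: a relation among the [m j] modulo [N] is one
    among the [q j]. So graded submodules have complements
    (graded_complement). To find gr-simple objects, take [p <> 0] in [M] and a
    graded submodule [N] maximal among those avoiding [p]. All nonzero graded
    submodules of [M / N] contain the class of [p], so no two of them are
    independent; by complements [M / N] is gr-simple, and any element of a
    pseudo-basis of it lifts to a pseudo-free element of [M] with a gr-simple
    object (exists_gr_simple_elt).

    Gr-simple pseudo-bases exist because a maximal independent set of such
    elements spans [M]; otherwise the previous result, applied to the quotient
    by its span, provides one more. For extension and additivity, a gr-simple
    sequence spanning [N], together with the lift of a gr-simple pseudo-basis
    of [M / N], is a gr-simple pseudo-basis of [M] (extend_basis): one takes
    for [N] the span of the given sequence, or for the sequence a gr-simple
    pseudo-basis of the given [N].

    The invariance of the cardinal is an exchange argument that treats finite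
    and infinite cardinals alike. Given an independent family [S] of nonzero
    graded submodules and a spanning family [T] of gr-simple ones, consider
    the partial injections from the indices of [S] to those of [T] for which
    replacing the matched [S i] by their partners keeps the family
    independent. Independence has finite character, so there is a maximal such
    injection. If it missed [i], the family without [S i] would not span,
    hence would fail to contain some [T j], hence would meet it trivially by
    gr-simplicity, and [i] could be matched with [j]. So the maximal injection
    is total (exchange_injection), and Cantor-Bernstein concludes
    (decomposition_card). *)

(** * Finitely supported sums *)
Section FiniteSums.
Variables (V : zmodType).

Lemma zclosed0 (N : set V) : zmod_closed [in N] -> N 0.
Proof. by case=> /set_mem. Qed.

Lemma zclosedB (N : set V) x y : zmod_closed [in N] -> N x -> N y -> N (x - y).
Proof.
by case=> _ NB Nx Ny; apply: set_mem; apply: NB; apply/mem_set.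
Qed.

Lemma zclosedD (N : set V) x y : zmod_closed [in N] -> N x -> N y -> N (x + y).
Proof.
move=> Nz Nx Ny; rewrite -[y]opprK -[- y]sub0r; apply: zclosedB => //.
by apply: zclosedB => //; apply: zclosed0.
Qed.

Lemma fin_supp0 (I : choiceType) : fin_supp (fun=> 0 : V) (I := I).
Proof. by apply: (@sub_finite_set _ _ set0) => // i; apply. Qed.

Lemma fsum_closed (I : choiceType) (N : set V) (f : I -> V) :
  zmod_closed [in N] -> (forall i, N (f i)) -> N (\sum_(i \in setT) f i).
Proof.
move=> Nz Nf; elim/big_ind: _ => // [|x y]; first exact: zclosed0.
exact: zclosedD.
Qed.

Lemma fin_supp_inj (I K : choiceType) (h : I -> K) (f : K -> V) :
  injective h -> fin_supp f -> fin_supp (f \o h).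
Proof.
move=> hinj ff; rewrite /fin_supp comp_preimage; apply: finite_preimage => //.
by move=> i j _ _; apply: hinj.
Qed.

Lemma fsum_inj (I K : choiceType) (h : I -> K) (f : K -> V) : injective h ->
  (forall k, ~ range h k -> f k = 0) ->
  \sum_(k \in setT) f k = \sum_(i \in setT) f (h i).
Proof.
move=> hinj f0; rewrite -(@fsbig_image _ _ _ _ _ setT h f); last first.
  by move=> i j _ _; apply: hinj.
by apply/esym/fsbig_widen => // k [_ kh]; apply: f0.
Qed.

Lemma fsum_sumtype (I J : choiceType) (f : (I + J)%type -> V) : fin_supp f ->
  \sum_(k \in setT) f k =
  \sum_(i \in setT) f (inl i) + \sum_(j \in setT) f (inr j).
Proof.
move=> ff.
pose fl k := if k is inl _ then f k else 0.
pose fr k := if k is inr _ then f k else 0.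
have -> : f = (fun k => fl k + fr k).
  by apply/funext => -[i|j]; rewrite /fl /fr ?addr0 ?add0r.
rewrite fsumD; last 2 first.
- by apply: (fin_supp_sub ff) => -[].
- by apply: (fin_supp_sub ff) => -[].
rewrite (@fsum_inj I _ inl fl); last 2 first.
- by move=> i j [].
- by move=> [i []|//]; exists i.
rewrite (@fsum_inj J _ inr fr); last 2 first.
- by move=> i j [].
- by move=> [//|j []]; exists j.
by congr (_ + _); apply: eq_fsbigr => i _ /=; rewrite ?addr0 ?add0r.
Qed.

End FiniteSums.

(** * Sums and independence of families of subgroups *)
Section DirectSums.
Variables (V : zmodType) (K : choiceType) (W : K -> set V).

(** The family [W] is fixed and the set [U] of indices varies, so that the
    maximality arguments range over subsets of one type. *)
Definition gsum (U : set K) : set V :=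
  [set y | exists f : K -> V, [/\ fin_supp f, forall k, W k (f k),
     forall k, ~ U k -> f k = 0 & y = \sum_(k \in setT) f k]].

Definition independent (U : set K) : Prop :=
  forall f : K -> V, fin_supp f -> (forall k, W k (f k)) ->
    (forall k, ~ U k -> f k = 0) ->
    \sum_(k \in setT) f k = 0 -> forall k, f k = 0.

Hypothesis Wz : forall k, zmod_closed [in W k].

Lemma gsum_zmod U : zmod_closed [in gsum U].
Proof.
split.
  apply/mem_set; exists (fun=> 0); split => //; first exact: fin_supp0.
  - by move=> k; apply: zclosed0.
  - by rewrite fsbig1.
move=> _ _ /set_mem [f [ff fW f0 ->]] /set_mem [g [fg gW g0 ->]].
apply/mem_set; exists (fun k => f k - g k); split.
- exact: fin_suppB.
- by move=> k; apply: zclosedB.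
- by move=> k Uk; rewrite f0 // g0 // subr0.
- by rewrite fsumB.
Qed.

Lemma gsum_sub (U : set K) k : U k -> W k `<=` gsum U.
Proof.
move=> Uk x Wx; exists (fun i => if i == k then x else 0); split.
- exact: fin_supp_single.
- by move=> i; case: eqP => [->//|_]; apply: zclosed0.
- by move=> i Ui; case: eqP => // ik; case: Ui; rewrite ik.
- by rewrite fsum_single.
Qed.

Lemma gsum_least (U : set K) (N : set V) : zmod_closed [in N] ->
  (forall k, U k -> W k `<=` N) -> gsum U `<=` N.
Proof.
move=> Nz WN _ [f [_ fW f0 ->]]; apply: fsum_closed => // k.
have [Uk|/f0->] := pselect (U k); first exact: (WN k).
exact: zclosed0.
Qed.

Lemma independent_sub (U U' : set K) :
  U `<=` U' -> independent U' -> independent U.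
Proof.
move=> UU' ind f ff fW f0; apply: ind => // k U'k.
by apply: f0 => /UU'.
Qed.

Lemma independent_disjoint (U : set K) k x : independent (U `|` [set k]) ->
  ~ U k -> W k x -> gsum U x -> x = 0.
Proof.
move=> ind Uk Wx [f [ff fW f0 xE]].
have := ind (fun i => f i - (if i == k then x else 0)).
have fs := fin_supp_single k x.
move=> /(_ (fin_suppB ff fs)) H.
have {}H : forall i, f i - (if i == k then x else 0) = 0.
  apply: H => [i|i Ui|].
  - apply: zclosedB => //; case: eqP => [->//|_]; exact: zclosed0.
  - rewrite f0 => [|Ui']; last by apply: Ui; left.
    by case: eqP => [ik|]; rewrite ?subr0 //; case: Ui; right.
  - by rewrite fsumB // fsum_single -xE subrr.
by have /eqP := H k; rewrite eqxx f0 // sub0r oppr_eq0 => /eqP.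
Qed.

(** This is the step by which a non-maximal independent family grows.  In a
    relation involving [W k], the [k]-th term is the opposite of the sum of the
    others, so it vanishes. *)
Lemma independent_add (U : set K) k : independent U ->
  (forall x, W k x -> gsum U x -> x = 0) -> independent (U `|` [set k]).
Proof.
move=> ind disj f ff fW f0 fsum0.
pose g i := if i == k then 0 else f i.
have fg : fin_supp g by apply: (fin_supp_sub ff) => i fi; rewrite /g fi if_same.
have gW i : W i (g i) by rewrite /g; case: eqP => // _; apply: zclosed0.
have g0 i : ~ U i -> g i = 0.
  by rewrite /g; case: eqP => // ik Ui; apply: f0 => -[].
have fE : f = (fun i => g i + (if i == k then f k else 0)).
  apply/funext => i; rewrite /g; case: eqP => [->|_]; first by rewrite add0r.
  by rewrite addr0.
have sE : \sum_(i \in setT) g i + f k = 0.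
  rewrite -[RHS]fsum0 [in RHS]fE fsumD ?fsum_single //.
  exact: fin_supp_single.
have gS : gsum U (\sum_(i \in setT) g i) by exists g.
have fk0 : f k = 0.
  apply: disj => //.
  have -> : f k = 0 - \sum_(i \in setT) g i.
    by apply/eqP; rewrite eq_sym subr_eq -[X in X == _]sE addrC.
  have Sz := gsum_zmod U.
  by apply: zclosedB => //; apply: zclosed0.
move: sE; rewrite fk0 addr0 => /(ind g fg gW g0) g00 i.
by rewrite fE g00 fk0 if_same addr0.
Qed.

End DirectSums.

Lemma internal_direct_sumE (V : zmodType) (K : choiceType) (W : K -> set V) :
  internal_direct_sum setT W <-> gsum W setT = setT /\ independent W setT.
Proof.
split=> [[_ tot ind]|[tot ind]]; split=> //.
- apply/seteqP; split=> // x _; have [f [ff fW ->]] := tot x I.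
  by exists f; split=> // k [].
- by move=> f ff fW _; apply: ind.
- move=> x _; have : gsum W setT x by rewrite tot.
  by move=> [f [ff fW _ ->]]; exists f.
- by move=> f ff fW; apply: ind => // k [].
Qed.

Lemma gsum_inj (V : zmodType) (I K : choiceType) (h : I -> K) (W : K -> set V)
    (U : set K) : (forall k, zmod_closed [in W k]) -> injective h ->
  (forall k, U k -> range h k) -> gsum W U `<=` gsum (W \o h) setT.
Proof.
move=> Wz hinj Uh _ [f [ff fW f0 ->]]; exists (f \o h); split => //.
- exact: fin_supp_inj.
- by move=> i; apply: fW.
- by move=> i [].
- by rewrite (fsum_inj hinj) // => k hk; apply: f0 => /Uh.
Qed.

(** * Finite character of independence *)
Lemma chain_finite (T : choiceType) (F : set (set T)) (A : set T) :
  total_on F subset -> F !=set0 -> finite_set A -> A `<=` \bigcup_(X in F) X ->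
  exists2 X, F X & A `<=` X.
Proof.
move=> Ftot [X0 FX0] /finite_seqP [s ->] {A}.
elim: s => [|x s IH] sF; first by exists X0.
have [X FX sX] : exists2 X, F X & [set` s] `<=` X.
  by apply: IH => y ys; apply: sF; rewrite /= inE (ys : y \in s) orbT.
have [|Y FY Yx] := sF x; first by rewrite /= inE eqxx.
have [XY|YX] := Ftot _ _ FX FY.
  by exists Y => // y /=; rewrite inE => /orP [/eqP ->//|/sX /XY].
by exists X => // y /=; rewrite inE => /orP [/eqP ->|/sX//]; apply: YX.
Qed.

Section FiniteCharacter.
Variables (V : zmodType) (K : choiceType) (W : K -> set V).

(** A relation involves only the finitely many members on its support.  This is
    what makes independence pass to unions of chains. *)
Lemma independent_finite (U : set K) :
  (forall A, finite_set A -> A `<=` U -> independent W A) -> independent W U.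
Proof.
move=> indA f ff fW f0; apply: (indA (f @^-1` [set~ 0])) => // k fk.
  by apply: contrapT => /f0.
exact: contrapT.
Qed.

Lemma independent_inj (I : choiceType) (h : I -> K) : injective h ->
  independent (W \o h) setT -> independent W (range h).
Proof.
move=> hinj ind f ff fW f0 fsum0.
have fh0 : forall i, f (h i) = 0.
  apply: ind => [|i|i []//|]; [exact: fin_supp_inj | exact: fW |].
  by rewrite -(fsum_inj hinj f0).
by move=> k; have [[i _ <-]//|] := pselect (range h k); apply: f0.
Qed.

Lemma independent_comp (I : choiceType) (h : I -> K) :
  (forall k, zmod_closed [in W k]) -> injective h ->
  independent W (range h) -> independent (W \o h) setT.
Proof.
move=> Wz hinj ind f ff fW _ fsum0.
have /choice [g gP] : forall k, exists y,
    (forall i, h i = k -> y = f i) /\ (~ range h k -> y = 0).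
  move=> k; have [[i _ <-]|hk] := pselect (range h k).
    exists (f i); split=> [j /hinj ->//|[]]; by exists i.
  by exists 0; split=> // i hik; case: hk; exists i.
have gf i : g (h i) = f i by case: (gP (h i)) => + _; apply.
have g0 k : ~ range h k -> g k = 0 by case: (gP k).
move=> i; rewrite -gf; apply: ind => //.
- apply: (@sub_finite_set _ _ (h @` (f @^-1` [set~ 0]))).
    move=> k /= gk; have [[j _ hj]|/g0//] := pselect (range h k).
    by exists j => //= fj; apply: gk; rewrite -hj gf.
  exact: finite_image.
- move=> k; have [[j _ <-]|/g0 ->] := pselect (range h k).
    by rewrite gf; apply: fW.
  exact: zclosed0.
- by rewrite (fsum_inj hinj g0) -[RHS]fsum0; apply: eq_fsbigr => j _.
Qed.

End FiniteCharacter.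

(** * Graded submodules and pseudo-free elements *)
Section GradedSubmodules.
Variables (G : groupoid) (R : grRing G).

Lemma gr_mul0r (a : R) : gr_mul a 0 = 0.
Proof. by apply: (addrI (gr_mul a 0)); rewrite -gr_mulDr !addr0. Qed.

Lemma gr_mulBr (a b c : R) : gr_mul a (b - c) = gr_mul a b - gr_mul a c.
Proof. by apply/eqP; rewrite eq_sym subr_eq -gr_mulDr subrK. Qed.

Lemma gr_one_idem (e : gobj G) : gr_mul (gr_one R e) (gr_one R e) = gr_one R e.
Proof. by have := gr_mul1l (gr_one_comp R e); rewrite gcod_id. Qed.

Lemma range_oneP (e : gobj G) (a : R) :
  range (gr_mul (gr_one R e)) a <-> gr_mul (gr_one R e) a = a.
Proof.
split=> [[b _ <-]|aE]; last by exists a.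
by rewrite gr_mulA gr_one_idem.
Qed.

Variable M : grModule R.

Lemma gm_actBr (x : M) a b : gm_act x (a - b) = gm_act x a - gm_act x b.
Proof. by apply/eqP; rewrite eq_sym subr_eq -gm_actDr subrK. Qed.

Lemma gm_act_one (c : G) (x : M) a : gm_comp c x ->
  gm_act x (gr_mul (gr_one R (gdom c)) a) = gm_act x a.
Proof. by move=> cx; rewrite -gm_actA gm_act1. Qed.

Lemma gm_act_fsum (I : choiceType) (x : M) (a : I -> R) : fin_supp a ->
  gm_act x (\sum_(i \in setT) a i) = \sum_(i \in setT) gm_act x (a i).
Proof.
by move=> fa; apply: fsum_morph; [exact: gm_act0r | exact: gm_actDr |].
Qed.

Lemma fsum_gm_act (I : choiceType) (x : I -> M) (a : R) : fin_supp x ->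
  gm_act (\sum_(i \in setT) x i) a = \sum_(i \in setT) gm_act (x i) a.
Proof.
move=> fx; apply: (fsum_morph (h := fun z => gm_act z a)) => //.
  exact: gm_act0l.
by move=> u v; apply: gm_actDl.
Qed.

Lemma gm_comp_indep : independent (@gm_comp G R M) setT.
Proof. by have /internal_direct_sumE [] := gm_comp_sum M. Qed.

Section OneSubmodule.
Variables (N : set M) (gN : graded_submodule N).

Lemma graded_zmod : zmod_closed [in N]. Proof. by case: gN. Qed.

Lemma graded_mem0 : N 0. Proof. exact: zclosed0 graded_zmod. Qed.

Lemma graded_memB x y : N x -> N y -> N (x - y).
Proof. exact: zclosedB graded_zmod. Qed.

Lemma graded_mem_act x a : N x -> N (gm_act x a).
Proof. by case: gN => _ + _; apply. Qed.

End OneSubmodule.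

Lemma zmod_closed_hom (N : set M) : zmod_closed [in N] ->
  forall c, zmod_closed [in N `&` gm_comp c].
Proof.
move=> Nz c; split.
  by apply/mem_set; split; [exact: zclosed0 | exact: gm_comp0].
move=> x y /set_mem [Nx cx] /set_mem [Ny cy]; apply/mem_set; split.
  exact: zclosedB.
exact: gm_compB.
Qed.

(** The uniqueness of the decomposition into homogeneous components is
    inherited from [M]; only their membership in [N] has to be checked. *)
Lemma graded_submoduleI (N : set M) : zmod_closed [in N] ->
  (forall x a, N x -> N (gm_act x a)) ->
  (forall x, N x -> gsum (fun c => N `&` gm_comp c) setT x) ->
  graded_submodule N.
Proof.
move=> Nz Nact Nsum; split=> //; split=> [c x [//]|x /Nsum|].
  by move=> [f [ff fN _ ->]]; exists f.
have [_ _ M0] := gm_comp_sum M => f ff fN.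
by apply: M0 => // c; case: (fN c).
Qed.

Lemma graded_hom_gsum (N : set M) x : graded_submodule N -> N x ->
  gsum (fun c => N `&` gm_comp c) setT x.
Proof.
move=> [_ _ [_ Nsum _]] /Nsum [f [ff fN ->]].
by exists f; split=> // c [].
Qed.

Lemma graded_hom_neq0 (N : set M) : graded_submodule N -> N <> [set 0] ->
  exists c x, [/\ N x, gm_comp c x & x <> 0].
Proof.
move=> gN N0; apply: contrapT => no; apply: N0.
apply/seteqP; split=> [x Nx|_ ->]; last exact: graded_mem0.
have [f [_ fN _ ->]] := graded_hom_gsum gN Nx.
rewrite fsbig1 // => c _; apply: contrapT => fc.
by apply: no; exists c, (f c); case: (fN c).
Qed.

(** Each term decomposes inside its own [W k].  Components of equal degree
    coming from different terms are never collected explicitly: the finite sums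
    of homogeneous elements of [gsum W U] form a subgroup. *)
Lemma graded_gsum (K : choiceType) (W : K -> set M) (U : set K) :
  (forall k, graded_submodule (W k)) -> graded_submodule (gsum W U).
Proof.
move=> gW; have Wz k : zmod_closed [in W k] by case: (gW k).
have gz := gsum_zmod Wz U.
apply: graded_submoduleI => // [x a [f [ff fW f0 ->]]|_ [f [_ fW f0 ->]]].
  exists (fun k => gm_act (f k) a); split.
  - by apply: (fin_supp_sub ff) => k ->; rewrite gm_act0l.
  - by move=> k; apply: graded_mem_act.
  - by move=> k /f0 ->; rewrite gm_act0l.
  - by rewrite fsum_gm_act.
have hz := zmod_closed_hom gz.
have sz := gsum_zmod hz setT; apply: (fsum_closed sz) => k.
have [Uk|/f0 ->] := pselect (U k); last exact: zclosed0.
have := graded_hom_gsum (gW k) (fW k).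
apply: gsum_least; first exact: gsum_zmod.
move=> c _ x [Wx cx]; apply: (gsum_sub hz (k := c)) => //; split=> //.
exact: (gsum_sub Wz Uk).
Qed.

Lemma cyclic_zmod (x : M) : zmod_closed [in cyclic_submodule x].
Proof.
split; first by apply/mem_set; exists 0 => //; rewrite gm_act0r.
move=> _ _ /set_mem [a _ <-] /set_mem [b _ <-]; apply/mem_set.
by exists (a - b) => //; rewrite gm_actBr.
Qed.

Lemma graded_cyclic (c : G) (x : M) : gm_comp c x ->
  graded_submodule (cyclic_submodule x).
Proof.
move=> cx; have xz := cyclic_zmod x.
apply: graded_submoduleI => // [_ b [a _ <-]|_ [a _ <-]].
  by exists (gr_mul a b) => //; rewrite gm_actA.
have [_ /(_ a I) [f [ff fR ->]] _] := gr_comp_sum R.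
have hz := zmod_closed_hom xz.
have sz := gsum_zmod hz setT.
rewrite gm_act_fsum //; apply: (fsum_closed sz) => d.
have [cd|cd] := pselect (gdom c = gcod d); last first.
  by rewrite (gm_comp_act0 cd cx (fR d)); apply: zclosed0.
apply: (@gsum_sub _ _ _ hz _ (gcomp c d)) => //; split; first by exists (f d).
exact: gm_comp_act.
Qed.

Lemma mem_cyclic (c : G) (x : M) : gm_comp c x -> cyclic_submodule x x.
Proof. by move=> cx; exists (gr_one R (gdom c)) => //; rewrite gm_act1. Qed.

Lemma gcomp_injr (c d d' : G) : gdom c = gcod d -> gdom c = gcod d' ->
  gcomp c d = gcomp c d' -> d = d'.
Proof.
move=> cd cd' E; rewrite -(gcomp_idl d) -(gcomp_idl d') -cd -cd'.
by rewrite -gcomp_invl -!gcompA ?E ?gdom_inv.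
Qed.

(** Expand [a] into homogeneous components [a_g].  Since [g |-> c g] is
    injective, at most one [x a_g] has degree [d]; the others add up to an
    element of degree [d] lying in the sum of the other components of [M], that
    is, to zero. *)
Lemma cyclic_hom (c d : G) (x : M) a : gm_comp c x -> gm_comp d (gm_act x a) ->
  exists g b, gr_comp g b /\ gm_act x a = gm_act x b.
Proof.
move=> cx dxa; have [_ /(_ a I) [f [ff fR aE]] _] := gr_comp_sum R.
have Mz := gm_comp_zmod M.
have sz := gsum_zmod Mz (~` [set d]).
pose good g := gdom c = gcod g /\ gcomp c g = d.
have bad g : ~ good g -> gsum (@gm_comp G R M) (~` [set d]) (gm_act x (f g)).
  move=> ng; have [cg|cg] := pselect (gdom c = gcod g); last first.
    by rewrite (gm_comp_act0 cg cx (fR g)); apply: zclosed0.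
  apply: (gsum_sub Mz (k := gcomp c g)); last exact: gm_comp_act.
  by move=> E; apply: ng.
have [g [b [gb badb]]] : exists g b, gr_comp g b /\
    gsum (@gm_comp G R M) (~` [set d]) (gm_act x a - gm_act x b) /\
    gm_comp d (gm_act x b).
  rewrite aE gm_act_fsum //.
  have [[g [cg gd]]|no] := pselect (exists g, good g); last first.
    (* No component of [x a] has degree [d], so [x a = 0] and [b = 0] do. *)
    exists (gid (gdom c)), 0; split.
      by apply: zclosed0 (gr_comp_zmod R _).
    rewrite gm_act0r subr0; split; last exact: gm_comp0.
    by apply: (fsum_closed sz) => g; apply: bad => gg; apply: no; exists g.
  exists g, (f g); split=> //; split; last by rewrite -gd; apply: gm_comp_act.
  rewrite -[gm_act x (f g)](fsum_single g) -fsumB; last 2 first.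
  - by apply: (fin_supp_sub ff) => i ->; rewrite gm_act0r.
  - exact: fin_supp_single.
  apply: (fsum_closed sz) => i.
  case: eqP => [->|ig]; first by rewrite subrr; apply: zclosed0.
  rewrite subr0; apply: bad => -[ci id]; apply: ig.
  by apply: (@gcomp_injr c) => //; rewrite id.
exists g, b; split=> //; apply/eqP; rewrite -subr_eq0; apply/eqP.
case: badb => bad1 dxb.
apply: (independent_disjoint Mz (U := ~` [set d]) (k := d)) => //.
- by apply: independent_sub gm_comp_indep.
- by apply.
- exact: gm_compB.
Qed.

Definition pseudo_free_elt (c : G) (x : M) : Prop :=
  [/\ gm_comp c x, x <> 0 & forall a,
     gr_mul (gr_one R (gdom c)) a = a -> gm_act x a = 0 -> a = 0].

End GradedSubmodules.

(** For [1_e <> 0] this says that [1_e R], as a graded right module, is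
    gr-simple: a nonzero homogeneous [a] generates it as soon as [a R] contains
    [1_e].  No module occurs in this formulation, which lets it be shared by
    submodules, quotients and lifts. *)
Definition gr_simple_object (G : groupoid) (R : grRing G) (e : gobj G) : Prop :=
  forall g (a : R), gr_comp g a -> gr_mul (gr_one R e) a = a -> a <> 0 ->
    exists b, gr_mul a b = gr_one R e.

(** * Gr-simple sequences *)
Section PseudoIndependence.
Variables (G : groupoid) (R : grRing G) (M : grModule R).

(** The map [a |-> x a] identifies [1_e R] with [x R] up to a shift of degrees,
    for [e] the domain of [c]; right inverses in [1_e R] correspond to multiples
    of [x a] that recover [x]. *)
Lemma gr_simple_cyclicP (c : G) (x : M) : pseudo_free_elt c x ->
  gr_simple (cyclic_submodule x) <-> gr_simple_object R (gdom c).
Proof.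
move=> [cx x0 xfree]; split=> [[gx _ xsimple] g a ga ea a0|esimple].
  have cg : gdom c = gcod g.
    apply: contrapT => cg; apply: a0; apply: xfree => //.
    exact: gm_comp_act0 cg cx ga.
  have dxa := gm_comp_act cg cx ga.
  have [|E|E] := xsimple _ (graded_cyclic dxa).
  - by move=> _ [b _ <-]; exists (gr_mul a b) => //; rewrite gm_actA.
  - case: a0; apply: xfree => //; have := mem_cyclic dxa.
    by rewrite E.
  - have := mem_cyclic cx; rewrite -E => -[b _ xE].
    exists b; apply/eqP; rewrite -subr_eq0; apply/eqP; apply: xfree.
      by rewrite gr_mulBr gr_mulA ea gr_one_idem.
    by rewrite gm_actBr -gm_actA xE gm_act1 // subrr.
split; [exact: graded_cyclic cx | |].
- by move=> E; apply: x0; have := mem_cyclic cx; rewrite E.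
move=> T gT Tx; have [->|T0] := pselect (T = [set 0]); [by left | right].
apply/seteqP; split=> //.
have [d [t [Tt dt t0]]] := graded_hom_neq0 gT T0.
have [a _ tE] := Tx _ Tt; rewrite -tE in Tt dt t0.
have [g [b [gb abE]]] := cyclic_hom cx dt; rewrite abE in Tt t0.
have cg : gdom c = gcod g.
  by apply: contrapT => cg; apply: t0; exact: gm_comp_act0 cg cx gb.
have [||b' bb'] := esimple g b gb.
- by rewrite cg gr_mul1l.
- by move=> b0; apply: t0; rewrite b0 gm_act0r.
move=> _ [z _ <-]; rewrite -(gm_act1 cx) -bb' -gm_actA.
by do 2! apply: graded_mem_act => //.
Qed.

(** Pseudo-linear independence splits into a condition on each [x i] alone and
    a condition on the submodules [x i R] only; the latter makes the theory of
    independent families of subgroups available. *)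
Lemma pseudo_lin_indepP (I : choiceType) (x : I -> M) (c : I -> G) :
  [/\ forall i, gm_comp (c i) (x i),
      forall i, x i <> 0 &
      forall a : I -> R, fin_supp a ->
        (forall i, range (gr_mul (gr_one R (gdom (c i)))) (a i)) ->
        \sum_(i \in setT) gm_act (x i) (a i) = 0 -> forall i, a i = 0] <->
  (forall i, pseudo_free_elt (c i) (x i)) /\
  independent (fun i => cyclic_submodule (x i)) setT.
Proof.
split=> [[cx x0 xind]|[xfree xind]].
  split=> [i|f ff fx _ fsum0 i].
    split=> // a ea xa0.
    have := xind (fun j => if j == i then a else 0) (fin_supp_single i a).
    move=> /(_ _ _ i); rewrite eqxx; apply=> [j|].
      apply/range_oneP; case: eqP => [->//|_]; exact: gr_mul0r.
    by rewrite fsbig1 // => j _; case: eqP => [->//|_]; rewrite gm_act0r.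
  have /choice [a aP] : forall j, exists a,
      [/\ gm_act (x j) a = f j, gr_mul (gr_one R (gdom (c j))) a = a &
          f j = 0 -> a = 0].
    move=> j; have [fj0|fj0] := pselect (f j = 0).
      by exists 0; rewrite fj0 gm_act0r gr_mul0r.
    have [b _ bE] := fx j; exists (gr_mul (gr_one R (gdom (c j))) b).
    by rewrite gm_act_one // gr_mulA gr_one_idem.
  have [<- _ _] := aP i; rewrite xind ?gm_act0r //.
  - by apply: (fin_supp_sub ff) => j; case: (aP j).
  - by move=> j; apply/range_oneP; case: (aP j).
  - by rewrite -[RHS]fsum0; apply: eq_fsbigr => j _; case: (aP j).
split=> [i|i|a fa ea sum0 i]; try by case: (xfree i).
have [_ _] := xfree i; apply; first exact/range_oneP/ea.
apply: (xind (fun i => gm_act (x i) (a i))) => //.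
- by apply: (fin_supp_sub fa) => j ->; rewrite gm_act0r.
- by move=> j; exists (a j).
- by move=> j [].
Qed.

Lemma gr_simple_sequenceP (I : choiceType) (x : I -> M) :
  gr_simple_sequence x <-> exists c : I -> G,
    [/\ forall i, pseudo_free_elt (c i) (x i),
        forall i, gr_simple_object R (gdom (c i)) &
        independent (fun i => cyclic_submodule (x i)) setT].
Proof.
split=> [[[c /pseudo_lin_indepP [xfree xind]] xsimple]|].
  by exists c; split=> // i; apply/gr_simple_cyclicP.
move=> [c [xfree esimple xind]].
split; first by exists c; apply/pseudo_lin_indepP.
by move=> i; apply/(gr_simple_cyclicP (xfree i)).
Qed.

Lemma span_gsum (I : choiceType) (x : I -> M) :
  Defs.span x = gsum (fun i => cyclic_submodule (x i)) setT.
Proof.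
apply/seteqP; split=> [_ [a [fa ->]]|_ [f [ff fx _ ->]]].
  exists (fun i => gm_act (x i) (a i)); split=> // [|i|i []//].
    by apply: (fin_supp_sub fa) => i ->; rewrite gm_act0r.
  by exists (a i).
have /choice [a aP] : forall j, exists a,
    gm_act (x j) a = f j /\ (f j = 0 -> a = 0).
  move=> j; have [fj0|fj0] := pselect (f j = 0).
    by exists 0; rewrite fj0 gm_act0r.
  by have [b _ bE] := fx j; exists b.
exists a; split; first by apply: (fin_supp_sub ff) => j; case: (aP j).
by apply: eq_fsbigr => j _; case: (aP j).
Qed.

Lemma graded_span (I : choiceType) (x : I -> M) :
  (forall i, exists c, gm_comp c (x i)) -> graded_submodule (Defs.span x).
Proof.
move=> hx; rewrite span_gsum; apply: graded_gsum => i.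
by have [c cx] := hx i; apply: graded_cyclic cx.
Qed.

Lemma basis_decomposition (I : choiceType) (x : I -> M) :
  gr_simple_pseudo_basis x ->
  gr_simple_decomposition (fun i => cyclic_submodule (x i)).
Proof.
move=> [[[c /pseudo_lin_indepP [_ xind]] xsimple] [_ xspan]]; split=> //.
by apply/internal_direct_sumE; rewrite -span_gsum.
Qed.

End PseudoIndependence.

(** * Invariance of the number of gr-simple summands *)
Section Exchange.
Variables (G : groupoid) (R : grRing G) (M : grModule R).

Lemma graded_setI (N P : set M) : graded_submodule N -> graded_submodule P ->
  graded_submodule (N `&` P).
Proof.
move=> gN gP; apply: graded_submoduleI => [|x a [Nx Px]|x [Nx Px]].
- split; first by apply/mem_set; split; apply: graded_mem0.
  move=> x y /set_mem [Nx Px] /set_mem [Ny Py]; apply/mem_set.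
  by split; apply: graded_memB.
- by split; apply: graded_mem_act.
have [f [ff fN _ xf]] := graded_hom_gsum gN Nx.
have [g [fg gP' _ xg]] := graded_hom_gsum gP Px.
exists f; split=> // [c|c []//]; have [Nf cf] := fN c; split=> //; split=> //.
suff -> : f c = g c by case: (gP' c).
apply: (internal_direct_sum_uniq (gm_comp_sum M) (gm_comp_zmod M)) => //.
- by move=> d; case: (fN d).
- by move=> d; case: (gP' d).
- by rewrite -xf.
Qed.

(** Partial injections are encoded by their graphs [F], and [U F] is the index
    set of the family obtained from [S] by exchanging each matched [S i] for its
    partner.  Only independence, and not spanning, is required of this family,
    because spanning would not survive unions of chains. *)
Lemma exchange_injection (I J : choiceType) (S : I -> set M) (T : J -> set M) :
  (forall i, graded_submodule (S i)) -> (forall i, S i <> [set 0]) ->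
  independent S setT ->
  (forall j, gr_simple (T j)) -> gsum T setT = setT ->
  exists f : I -> J, injective f.
Proof.
move=> gS S0 indS sT spanT.
pose W (k : I + J) := match k with inl i => S i | inr j => T j end.
have gW k : graded_submodule (W k) by case: k => [i|j] //=; case: (sT j).
have Wz k : zmod_closed [in W k] by apply: graded_zmod.
pose U (F : set (I * J)) : set (I + J) :=
  [set k | match k with
           | inl i => ~ exists j, F (i, j)
           | inr j => exists i, F (i, j)
           end].
pose P (F : set (I * J)) := [/\ forall i j j', F (i, j) -> F (i, j') -> j = j',
  forall i i' j, F (i, j) -> F (i', j) -> i = i' & independent W (U F)].
have [F [[Ffun Finj Find] Fmax]] :
    exists F, P F /\ forall F', F `<` F' -> ~ P F'.
  apply: Zorn_bigcup => C CP Ctot; split=> [i j j'|i i' j|].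
  - move=> [X CX Xij] [Y CY Yij]; have [XY|YX] := Ctot _ _ CX CY.
      by have [+ _ _] := CP _ CY; apply; [apply: XY; exact: Xij|].
    by have [+ _ _] := CP _ CX; apply; [exact: Xij|apply: YX].
  - move=> [X CX Xij] [Y CY Yij]; have [XY|YX] := Ctot _ _ CX CY.
      by have [_ + _] := CP _ CY; apply; [apply: XY; exact: Xij|].
    by have [_ + _] := CP _ CX; apply; [exact: Xij|apply: YX].
  apply: independent_finite => A Afin AU.
  (* [U X] is not monotone in [X], as it loses the matched indices of [S];
     [U' X] keeps them all, so that a finite part of the union can be located
     in one member of the chain. *)
  pose U' (X : set (I * J)) : set (I + J) :=
    [set k | match k with inl i => True | inr j => exists i, X (i, j) end].
  have [C0|/nonemptyPn Ce] := pselect (C !=set0); last first.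
    apply: (@independent_sub _ _ _ A (range inl)).
      by move=> [i|j] /AU; [exists i | move=> /= [i [X]]; rewrite Ce].
    by apply: independent_inj => // i i' [].
  have [_ [X CX <-] AX] : exists2 Y, (U' @` C) Y & A `<=` Y.
    apply: chain_finite => //.
    - move=> _ _ [X CX <-] [Y CY <-].
      have [XY|YX] := Ctot _ _ CX CY; [left|right] => -[i|j] //= [i].
        by move=> /XY; exists i.
      by move=> /YX; exists i.
    - by have [X CX] := C0; exists (U' X), X.
    move=> [i|j] /=; first by have [X CX] := C0; exists (U' X) => //; exists X.
    move=> /AU [i [Y CY Yij]]; exists (U' Y); first by exists Y.
    by exists i.
  have [_ _ indX] := CP _ CX; apply: independent_sub indX => k Ak.
  move: (AX _ Ak) (AU _ Ak); case: k {Ak} => //= i _ no [j Xij].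
  by apply: no; exists j, X.
suff /choice [f fP] : forall i, exists j, F (i, j).
  by exists f => i i' E; apply: (Finj i i' (f i)) => //; rewrite E.
move=> i; apply: contrapT => Fi.
pose U0 := U F `\ inl i.
have UE : U F = U0 `|` [set inl i].
  apply/seteqP; split=> [k Uk|k [[]//|->//]].
  by have [->|ki] := pselect (k = inl i); [right | left].
have S_U0 x : S i x -> gsum W U0 x -> x = 0.
  apply: (@independent_disjoint _ _ W Wz U0 (inl i) x); first by rewrite -UE.
  by case=> _; apply.
have gU0 : graded_submodule (gsum W U0) by apply: graded_gsum.
(* If the family without [S i] contained all [T j] it would span, and [S i]
   would be zero by independence. *)
have [j Tj] : exists j, ~ (T j `<=` gsum W U0).
  apply: contrapT => no.
  have all y : gsum W U0 y.
    have : gsum T setT y by rewrite spanT.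
    apply: gsum_least; first exact: graded_zmod.
    by move=> j _; apply: contrapT => Tj; apply: no; exists j.
  apply: (S0 i); apply/seteqP; split=> [x Sx|_ ->]; last exact: graded_mem0.
  exact: S_U0.
have Fj : ~ exists i', F (i', j).
  move=> [i' Fij]; apply: Tj => y Ty; apply: (gsum_sub Wz (k := inr j)) => //.
  by split=> //; exists i'.
have TU0 : T j `&` gsum W U0 = [set 0].
  have [gT _ Tsimple] := sT j.
  have [||//|TE] := Tsimple (T j `&` gsum W U0).
  - exact: graded_setI.
  - by move=> y [].
  - by case: Tj; rewrite -TE => y [].
pose F' := F `|` [set (i, j)].
have FF' : F `<` F'.
  rewrite properEneq; split; last by move=> ? ?; left.
  by apply/eqP => E; apply: Fi; exists j; rewrite E; right.
apply: (Fmax F' FF'); split.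
- move=> i1 j1 j2 [F1|[i1E ->]] [F2|[i1E' ->]] //.
  + exact: Ffun F1 F2.
  + by case: Fi; exists j1; rewrite -i1E'.
  + by case: Fi; exists j2; rewrite -i1E.
- move=> i1 i2 j1 [F1|[-> j1E]] [F2|[-> j1E']] //.
  + exact: Finj F1 F2.
  + by case: Fj; exists i1; rewrite -j1E'.
  + by case: Fj; exists i2; rewrite -j1E.
suff UF' : U F' `<=` U0 `|` [set inr j].
  apply: independent_sub UF' _; apply: independent_add => //.
    by apply: independent_sub Find => k [].
  move=> x Tx Ux; have : (T j `&` gsum W U0) x by [].
  by rewrite TU0.
move=> [i1|j1] /=.
  move=> no; left; split=> /= [[j1 Fij]|[ii]].
    by apply: no; exists j1; left.
  by apply: no; exists j; right; rewrite ii.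
by move=> [i1 [Fij|[_ ->]]]; [left; split=> //; exists i1 | right].
Qed.

Lemma decomposition_card (I J : choiceType) (S : I -> set M) (T : J -> set M) :
  gr_simple_decomposition S -> gr_simple_decomposition T ->
  ([set: I] #= [set: J])%card.
Proof.
have le (A B : choiceType) (X : A -> set M) (Y : B -> set M) :
    gr_simple_decomposition X -> gr_simple_decomposition Y ->
    ([set: A] #<= [set: B])%card.
  move=> [Xs /internal_direct_sumE [_ Xind]] [Ys /internal_direct_sumE [Yt _]].
  have [f finj] : exists f : A -> B, injective f.
    apply: (@exchange_injection _ _ X Y) => // a; first by case: (Xs a).
    by case: (Xs a).
  rewrite -(card_le_eql (inj_card_eq (A := setT) (in2W finj))).
  exact: subset_card_le.
by move=> HS HT; apply: Cantor_Bernstein; apply: le; eassumption.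
Qed.

End Exchange.
(** * Lifting from a graded quotient *)
Section Lifting.
Variables (G : groupoid) (R : grRing G) (M : grModule R) (N : grSubmodule M).

Lemma quo_pi_fsum (I : choiceType) (f : I -> M) : fin_supp f ->
  quo_pi N (\sum_(i \in setT) f i) = \sum_(i \in setT) quo_pi N (f i).
Proof.
by move=> ff; apply: fsum_morph; [exact: quo_pi0 | exact: quo_piD |].
Qed.

Lemma quo_pi_comb (J : choiceType) (m : J -> M) (q : J -> quoGrModule N)
    (a : J -> R) : (forall j, quo_pi N (m j) = q j) -> fin_supp a ->
  quo_pi N (\sum_(j \in setT) gm_act (m j) (a j)) =
  \sum_(j \in setT) gm_act (q j) (a j).
Proof.
move=> mq fa; rewrite quo_pi_fsum; last first.
  by apply: (fin_supp_sub fa) => j ->; rewrite gm_act0r.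
apply: eq_fsbigr => j _; rewrite -mq /=; exact/esym/quo_act_pi.
Qed.

Lemma quo_pi_mem (x : M) : quo_pi N x = 0 <-> (N : set M) x.
Proof.
split=> [x0|Nx].
  apply: gs_predP; rewrite -[x]subr0; apply/quo_pi_eq.
  by rewrite x0 quo_pi0.
rewrite -(quo_pi0 N); apply/quo_pi_eq; rewrite subr0; exact: gs_memP.
Qed.

Lemma lift_free_elt (c : G) (m : M) : gm_comp c m ->
  pseudo_free_elt c (quo_pi N m : quoGrModule N) -> pseudo_free_elt c m.
Proof.
move=> cm [_ m0 mfree]; split=> // [m0'|a ea ma].
  by apply: m0; rewrite m0' quo_pi0.
by apply: mfree => //; rewrite /= quo_act_pi ma quo_pi0.
Qed.

Lemma hom_lift (J : choiceType) (d : J -> G) (q : J -> quoGrModule N) :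
  (forall j, gm_comp (d j) (q j)) ->
  exists m : J -> M, forall j, gm_comp (d j) (m j) /\ quo_pi N (m j) = q j.
Proof.
move=> dq; have /choice [m mP] : forall j, exists m,
    gm_comp (d j) m /\ quo_pi N m = q j.
  by move=> j; have [m dm mq] := dq j; exists m.
by exists m.
Qed.

(** Coefficients in [1_(d j) R] are needed to use the independence of [q]; as
    [m j 1_(d j) = m j], replacing [a j] by [1_(d j) a j] is harmless. *)
Lemma lift_span_disjoint (J : choiceType) (d : J -> G) (q : J -> quoGrModule N)
    (m : J -> M) x :
  (forall j, gm_comp (d j) (m j) /\ quo_pi N (m j) = q j) ->
  (forall j, pseudo_free_elt (d j) (q j)) ->
  independent (fun j => cyclic_submodule (q j)) setT ->
  (N : set M) x -> Defs.span m x -> x = 0.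
Proof.
move=> mP qfree qind Nx [a [fa xE]].
have [dq _ qindep] := (pseudo_lin_indepP q d).2 (conj qfree qind).
pose b j := gr_mul (gr_one R (gdom (d j))) (a j).
have fb : fin_supp b.
  by apply: (fin_supp_sub fa) => j aj; rewrite /b aj gr_mul0r.
have {}xE : x = \sum_(j \in setT) gm_act (m j) (b j).
  rewrite xE; apply: eq_fsbigr => j _; rewrite gm_act_one //; by case: (mP j).
have b0 : forall j, b j = 0.
  apply: qindep => //.
  rewrite -(quo_pi_comb (m := m)) //; last by move=> j; case: (mP j).
  by rewrite -xE; apply/quo_pi_mem.
by rewrite xE fsbig1 // => j _; rewrite b0 gm_act0r.
Qed.

Lemma lift_span_total (J : choiceType) (q : J -> quoGrModule N)
    (m : J -> M) x : (forall j, quo_pi N (m j) = q j) ->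
  Defs.span q = setT -> exists y, Defs.span m y /\ (N : set M) (x - y).
Proof.
move=> mq qT; have [a [fa xE]] : Defs.span q (quo_pi N x) by rewrite qT.
exists (\sum_(j \in setT) gm_act (m j) (a j)); split; first by exists a.
apply/quo_pi_mem; rewrite quo_piB (quo_pi_comb mq fa) -xE; exact: subrr.
Qed.

(** A relation between the [x i] and the [m j] becomes, modulo [N], one between
    the [q j], so the coefficients of the [m j] vanish first.  Each [m j R] is
    gr-simple because [m j] and [q j] have the same degree, hence the same
    object. *)
Lemma extend_basis (I J : choiceType) (x : I -> M) (q : J -> quoGrModule N) :
  gr_simple_sequence x -> Defs.span x = N -> gr_simple_pseudo_basis q ->
  exists m : J -> M, gr_simple_pseudo_basis
    (fun k : (I + J)%type => match k with inl i => x i | inr j => m j end).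
Proof.
move=> /gr_simple_sequenceP [c [xfree xsimple xind]] xN.
move=> [/gr_simple_sequenceP [d [qfree qsimple qind]] [_ qT]].
have [m mP] : exists m : J -> M,
    forall j, gm_comp (d j) (m j) /\ quo_pi N (m j) = q j.
  by apply: hom_lift => j; case: (qfree j).
pose y (k : I + J) := match k with inl i => x i | inr j => m j end.
exists m; change (gr_simple_pseudo_basis y).
have mfree j : pseudo_free_elt (d j) (m j).
  have [dm mq] := mP j; apply: lift_free_elt => //; rewrite mq; exact: qfree.
have [cx _ xindep] := (pseudo_lin_indepP x c).2 (conj xfree xind).
have [_ _ qindep] := (pseudo_lin_indepP q d).2 (conj qfree qind).
have mq j : quo_pi N (m j) = q j by case: (mP j).
pose cd (k : I + J) := match k with inl i => c i | inr j => d j end.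
have fy (a : (I + J)%type -> R) : fin_supp a ->
    fin_supp (fun k => gm_act (y k) (a k)).
  by move=> fa; apply: (fin_supp_sub fa) => k ->; rewrite gm_act0r.
have inlI : injective (@inl I J) by move=> ? ? [].
have inrI : injective (@inr I J) by move=> ? ? [].
have yindep : pseudo_lin_indep y.
  exists cd; split=> [[i|j]|[i|j]|a fa ea sum0] /=.
  - by case: (xfree i).
  - by case: (mfree j).
  - by case: (xfree i).
  - by case: (mfree j).
  rewrite (fsum_sumtype (fy a fa)) /= in sum0.
  have far : fin_supp (a \o inr) by apply: fin_supp_inj.
  have fal : fin_supp (a \o inl) by apply: fin_supp_inj.
  have suml0 : quo_pi N (\sum_(i \in setT) gm_act (x i) (a (inl i))) = 0.
    by apply/quo_pi_mem; rewrite -xN; exists (a \o inl).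
  have ar0 : forall j, a (inr j) = 0.
    apply: (qindep (a \o inr)) => // [j|]; first exact: (ea (inr j)).
    rewrite -(quo_pi_comb mq far) -[LHS]add0r -[X in X + _]suml0 -quo_piD.
    by rewrite sum0 quo_pi0.
  have al0 : forall i, a (inl i) = 0.
    apply: (xindep (a \o inl)) => // [i|]; first exact: (ea (inl i)).
    rewrite -[RHS]sum0 [X in _ = _ + X]fsbig1 ?addr0 // => j _.
    by rewrite ar0 gm_act0r.
  by case.
have ysimple k : gr_simple (cyclic_submodule (y k)).
  case: k => [i|j]; first by apply/(gr_simple_cyclicP (xfree i)).
  by apply/(gr_simple_cyclicP (mfree j)).
apply: (conj (conj yindep ysimple) (conj yindep _)).
apply/seteqP; split=> // z _.
have [w [[b [fb wE]] Nzw]] := lift_span_total z mq qT.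
rewrite -xN in Nzw; case: Nzw => a [fa aE].
pose e (k : I + J) := match k with inl i => a i | inr j => b j end.
have fe : fin_supp e.
  apply: (@sub_finite_set _ _ ((inl @` (a @^-1` [set~ 0])) `|`
    (inr @` (b @^-1` [set~ 0])))).
    by move=> [i|j] /= ?; [left; exists i | right; exists j].
  by rewrite finite_setU; split; apply: finite_image.
exists e; split=> //; rewrite (fsum_sumtype (fy e fe)) /=.
by rewrite -aE -wE subrK.
Qed.

End Lifting.
(** * Modules over a pfm ring *)
Section PfmRings.
Variables (G : groupoid) (R : grRing G).
Hypothesis hR : pfm_ring R.

(** The quotient [M / N] is pseudo-free, and a homogeneous lift of a
    pseudo-basis splits the projection onto it. *)
Lemma graded_complement (M : grModule R) (N : set M) : graded_submodule N ->
  exists P : set M, [/\ graded_submodule P,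
    forall x, N x -> P x -> x = 0 &
    forall x, exists y, P y /\ N (x - y)].
Proof.
move=> gN; pose N' := GrSubmodule gN.
have [J [q [[d /pseudo_lin_indepP [qfree qind]] qT]]] := hR (quoGrModule N').
have [m mP] : exists m : J -> M,
    forall j, gm_comp (d j) (m j) /\ quo_pi N' (m j) = q j.
  by apply: hom_lift => j; case: (qfree j).
exists (Defs.span m); split=> [|x|x].
- by apply: graded_span => j; exists (d j); case: (mP j).
- exact: lift_span_disjoint mP qfree qind.
- by apply: (@lift_span_total _ _ _ N' _ q) => // j; case: (mP j).
Qed.

(** Under these hypotheses [M] is gr-simple, since a nonzero graded submodule
    and a nonzero complement of it would share [p].  For a homogeneous [a <> 0]
    in [1_e R], the submodule [x a R] is therefore all of [M], so it contains
    [x]. *)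
Lemma gr_simple_object_core (M : grModule R) (p : M) (c : G) (x : M) :
  p <> 0 -> (forall T : set M, graded_submodule T -> T <> [set 0] -> T p) ->
  pseudo_free_elt c x -> gr_simple_object R (gdom c).
Proof.
move=> p0 core [cx x0 xfree] g a ga ea a0.
have cg : gdom c = gcod g.
  apply: contrapT => cg; apply: a0; apply: xfree => //.
  exact: gm_comp_act0 cg cx ga.
have dxa := gm_comp_act cg cx ga.
have gxa := graded_cyclic dxa.
have [P [gP disj tot]] := graded_complement gxa.
have xap : cyclic_submodule (gm_act x a) p.
  apply: core => // E; apply: a0; apply: xfree => //.
  by have := mem_cyclic dxa; rewrite E.
have P0 : P = [set 0].
  by apply: contrapT => /(core _ gP) Pp; apply: p0; apply: disj.
have [y [Py [b _ xE]]] := tot x.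
rewrite P0 in Py; rewrite Py subr0 in xE.
exists b; apply/eqP; rewrite -subr_eq0; apply/eqP; apply: xfree.
  by rewrite gr_mulBr gr_mulA ea gr_one_idem.
by rewrite gm_actBr -gm_actA xE gm_act1 // subrr.
Qed.

(** The empty set is admitted among the candidates so that the union of the
    empty chain is one of them. *)
Lemma maximal_avoiding (M : grModule R) (p : M) : p <> 0 ->
  exists N : set M, [/\ graded_submodule N, ~ N p &
    forall N', graded_submodule N' -> N `<` N' -> N' p].
Proof.
move=> p0; pose P (N : set M) := (N = set0 \/ graded_submodule N) /\ ~ N p.
have [N [[NE Np] Nmax]] : exists N, P N /\ forall N', N `<` N' -> ~ P N'.
  apply: Zorn_bigcup => F FP Ftot; split; last by move=> [N /FP [_ +]].
  have [Fe|] := pselect (exists2 N, F N & N !=set0); last first.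
    move=> no; left; apply/seteqP; split=> // x [N FN Nx].
    by apply: no; exists N => //; exists x.
  right; have gF N x : F N -> N x -> graded_submodule N.
    by move=> /FP [[->//|//]].
  apply: graded_submoduleI.
  - split; first by have [N FN [x Nx]] := Fe; apply/mem_set; exists N => //;
      apply: graded_mem0; apply: gF Nx.
    move=> x y /set_mem [N1 F1 N1x] /set_mem [N2 F2 N2y]; apply/mem_set.
    have [N12|N21] := Ftot _ _ F1 F2.
      by exists N2 => //; apply: graded_memB; [apply: gF N2y| apply: N12|].
    by exists N1 => //; apply: graded_memB; [apply: gF N1x| |apply: N21].
  - move=> x a [N FN Nx]; exists N => //.
    by apply: graded_mem_act => //; apply: gF Nx.
  - move=> x [N FN Nx].
    have [f [ff fN f0 ->]] := graded_hom_gsum (gF _ _ FN Nx) Nx.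
    exists f; split=> // c; have [Nf cf] := fN c; split=> //; by exists N.
have g0 : graded_submodule [set (0 : M)].
  apply: graded_submoduleI => [|x a ->|x ->].
  - split; first exact/mem_set.
    by move=> x y /set_mem -> /set_mem ->; apply/mem_set; rewrite subr0.
  - by rewrite gm_act0l.
  - exists (fun=> 0); split=> //; first exact: fin_supp0.
      by move=> c; split=> //; apply: gm_comp0.
    by rewrite fsbig1.
exists N; split=> // [|N' gN' NN'].
  case: NE => // N0; have := Nmax [set 0]; rewrite N0 => H; exfalso.
  apply: H; last by split; [right|move=> /= /p0].
  by split=> // /(_ 0); apply.
by apply: contrapT => N'p; apply: (Nmax N') => //; split=> //; right.
Qed.

(** Homogeneous components downstairs lift to homogeneous elements; what remains
    is an element of [N], which is graded and contained in the preimage. *)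
Lemma graded_preimage (M : grModule R) (N : grSubmodule M)
    (T : set (quoGrModule N)) :
  graded_submodule T -> graded_submodule (quo_pi N @^-1` T).
Proof.
move=> gT.
have pz : zmod_closed [in quo_pi N @^-1` T].
  split; first by apply/mem_set => /=; rewrite quo_pi0; apply: (graded_mem0 gT).
  move=> x y /set_mem Tx /set_mem Ty; apply/mem_set => /=.
  by rewrite quo_piB; apply: (graded_memB gT).
have hz := zmod_closed_hom pz.
have sz := gsum_zmod hz setT.
apply: graded_submoduleI => // [x a Tx|x Tx].
  by rewrite /= -quo_act_pi; apply: (graded_mem_act gT).
have [f [ff fT _ fE]] := graded_hom_gsum gT Tx.
have /choice [m mP] : forall c, exists y,
    [/\ gm_comp c y, quo_pi N y = f c & f c = 0 -> y = 0].
  move=> c; have [fc0|fc0] := pselect (f c = 0).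
    by exists 0; split=> //; [exact: gm_comp0 | rewrite quo_pi0].
  by have [_ [y cy yE]] := fT c; exists y.
have fm : fin_supp m by apply: (fin_supp_sub ff) => c; case: (mP c).
rewrite -[x](subrK (\sum_(c \in setT) m c)); apply: zclosedD => //.
  have : (N : set M) (x - \sum_(c \in setT) m c).
    apply/quo_pi_mem; rewrite quo_piB quo_pi_fsum // fE.
    apply/eqP; rewrite subr_eq0; apply/eqP/eq_fsbigr => c _.
    by case: (mP c).
  move=> /(graded_hom_gsum (gs_graded N)); apply: gsum_least => //.
  move=> c _ y [Ny cy]; apply: (gsum_sub hz (k := c)) => //; split=> //=.
  by rewrite (quo_pi_mem N y).2 //; apply: (graded_mem0 gT).
exists m; split=> // [c|c []//]; have [cm mE _] := mP c; split=> //=.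
by rewrite mE; case: (fT c).
Qed.

(** This is the existence of gr-simple submodules in nonzero modules.  The
    maximality of [N] is what makes the class of [p] belong to all nonzero
    graded submodules of [M / N]. *)
Lemma exists_gr_simple_elt (M : grModule R) (p : M) : p <> 0 ->
  exists c (x : M), pseudo_free_elt c x /\ gr_simple_object R (gdom c).
Proof.
move=> p0; have [N [gN Np Nmax]] := maximal_avoiding p0.
pose N' := GrSubmodule gN.
have piN x : quo_pi N' x = 0 <-> N x := quo_pi_mem N' x.
have pp0 : quo_pi N' p <> 0 by move=> /piN.
have [J [q [[d /pseudo_lin_indepP [qfree qind]] qT]]] := hR (quoGrModule N').
have [j _] : exists j : J, True.
  apply: contrapT => no; apply: pp0.
  have [a [_ ->]] : Defs.span q (quo_pi N' p) by rewrite qT.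
  by rewrite fsbig1 // => j _; case: no; exists j.
have [[x dx xq] _ _] := qfree j.
exists (d j), x; split.
  by apply: (lift_free_elt (N := N')) => //; rewrite xq; apply: qfree.
apply: (@gr_simple_object_core (quoGrModule N') _ _ _ pp0 _ (qfree j)).
move=> T gT T0.
have [c [t [Tt _ t0]]] := graded_hom_neq0 gT T0.
apply: (Nmax (quo_pi N' @^-1` T)); first exact: graded_preimage.
split; first by move=> y /piN /= ->; apply: (graded_mem0 gT).
move=> /(_ (repr t)); rewrite /= quo_piK => /(_ Tt) /piN.
by rewrite quo_piK.
Qed.

(** The elements sought are indexed by themselves: take a maximal set [B] of
    them whose cyclic submodules are independent.  If [B] did not span, a lift
    [m] of an element of the quotient by its span could be added to it, as
    [m R] embeds in the quotient. *)
Lemma exists_gr_simple_pseudo_basis (M : grModule R) :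
  exists (I : choiceType) (x : I -> M), gr_simple_pseudo_basis x.
Proof.
pose simple_elt (x : M) :=
  exists c, pseudo_free_elt c x /\ gr_simple_object R (gdom c).
pose W := @cyclic_submodule G R M.
have Wz x : zmod_closed [in W x] by apply: cyclic_zmod.
pose P (B : set M) := B `<=` simple_elt /\ independent W B.
have [B [[Bs Bind] Bmax]] : exists B, P B /\ forall B', B `<` B' -> ~ P B'.
  apply: Zorn_bigcup => F FP Ftot; split.
    by move=> x [B /FP [Bs _]] /Bs.
  apply: independent_finite => A Afin AF.
  have [[B FB]|/nonemptyPn F0] := pselect (F !=set0).
    have [X FX AX] := chain_finite Ftot (ex_intro _ B FB) Afin AF.
    by have [_ Xind] := FP _ FX; apply: independent_sub Xind.
  move=> f _ _ f0 _ k; apply: f0 => /AF [X].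
  by rewrite F0.
pose x (b : set_type B) : M := val b.
have xinj : injective x by apply: val_inj.
have xB : range x = B.
  apply/seteqP; split=> [_ [b _ <-]|b Bb]; first exact: set_valP.
  by exists (SigSub (mem_set Bb)).
have /choice [c cP] : forall b, exists c,
    pseudo_free_elt c (x b) /\ gr_simple_object R (gdom c).
  by move=> b; apply: Bs; exact: set_valP.
have xind : independent (fun b => cyclic_submodule (x b)) setT.
  by apply: (independent_comp (W := W)) => //; rewrite xB.
have xseq : gr_simple_sequence x.
  apply/gr_simple_sequenceP; exists c; split=> // b; by case: (cP b).
exists (set_type B), x; split=> //; split; first by case: xseq.
have gx : graded_submodule (Defs.span x).
  by apply: graded_span => b; exists (c b); case: (cP b) => -[].
pose N := GrSubmodule gx.
apply: contrapT => xT.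
have [z Nz] : exists z, ~ Defs.span x z.
  apply: contrapT => no; apply: xT; apply/seteqP; split=> // z _.
  by apply: contrapT => Nz; apply: no; exists z.
have z0 : quo_pi N z <> 0 by move=> /quo_pi_mem.
have [d [q [qfree dsimple]]] := @exists_gr_simple_elt (quoGrModule N) _ z0.
have [[m dm mq] q0 qf] := qfree.
have mfree : pseudo_free_elt d m.
  by apply: (lift_free_elt (N := N)) => //; rewrite mq.
have disj y : W m y -> gsum W B y -> y = 0.
  move=> [a _ <-] By.
  have Ny : Defs.span x (gm_act m a).
    rewrite span_gsum; apply: (gsum_inj (W := W) (U := B)) => //.
    by rewrite xB.
  rewrite -(gm_act_one a dm) [gr_mul _ a]qf ?gm_act0r //.
    by rewrite gr_mulA gr_one_idem.
  by rewrite gm_act_one ?/= -?mq ?quo_act_pi; [apply/(quo_pi_mem N)|exists m].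
have Bm : ~ B m.
  move=> Bm; have [_ m0 _] := mfree; apply: m0; apply: disj.
    exact: mem_cyclic dm.
  by apply: (gsum_sub Wz Bm); exact: mem_cyclic dm.
apply: (Bmax (B `|` [set m])).
  by split=> [y By|/(_ m)]; [left | move=> H; apply: Bm; apply: H; right].
split; last exact: independent_add.
by move=> y [/Bs//|->]; exists d.
Qed.

Lemma spdim_basis (M : grModule R) :
  exists x : spdim M -> M, gr_simple_pseudo_basis x.
Proof.
rewrite /spdim; case: pselect => [h|]; first by case: (cid h).
by case; apply: exists_gr_simple_pseudo_basis.
Qed.

Lemma sdim_decomposition (M : grModule R) :
  exists S : sdim M -> set M, gr_simple_decomposition S.
Proof.
rewrite /sdim; case: pselect => [h|]; first by case: (cid h).
have [I [x /basis_decomposition xd]] := exists_gr_simple_pseudo_basis M.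
by case; exists I, (fun i => cyclic_submodule (x i)).
Qed.

Lemma basis_card (M : grModule R) (I J : choiceType) (x : I -> M) (y : J -> M) :
  gr_simple_pseudo_basis x -> gr_simple_pseudo_basis y ->
  ([set: I] #= [set: J])%card.
Proof.
move=> /basis_decomposition xd /basis_decomposition yd.
exact: decomposition_card xd yd.
Qed.

Lemma extend_gr_simple_sequence (M : grModule R) (I : choiceType) (x : I -> M) :
  gr_simple_sequence x ->
  exists (J : choiceType) (y : J -> M) (f : I -> J),
    [/\ gr_simple_pseudo_basis y, injective f & forall i, y (f i) = x i].
Proof.
move=> xseq; have gx : graded_submodule (Defs.span x).
  apply: graded_span => i; have [[c [cx _ _]] _] := xseq.
  by exists (c i).
have [J [q qb]] := exists_gr_simple_pseudo_basis (quoGrModule (GrSubmodule gx)).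
have [m yb] := extend_basis xseq (erefl : Defs.span x = GrSubmodule gx) qb.
exists (I + J)%type.
exists (fun k => match k with inl i => x i | inr j => m j end), inl.
by split=> // i i' [].
Qed.

Lemma sub_basis_sequence (M : grModule R) (N : grSubmodule M) (I : choiceType)
    (x : I -> subGrModule N) : gr_simple_pseudo_basis x ->
  gr_simple_sequence (fun i => sub_val (x i)) /\
  Defs.span (fun i => sub_val (x i)) = N.
Proof.
move=> [/gr_simple_sequenceP [c [xfree xsimple xind]] [_ xT]].
have [cx x0 xindep] := (pseudo_lin_indepP x c).2 (conj xfree xind).
have val_sum a : fin_supp a ->
    sub_val (\sum_(i \in setT) gm_act (x i) (a i)) =
    \sum_(i \in setT) gm_act (sub_val (x i)) (a i).
  move=> fa; rewrite (fsum_morph (h := @sub_val _ _ _ N)) //.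
  by apply: (fin_supp_sub fa) => i ->; rewrite gm_act0r.
split.
  have [vfree vind] := (pseudo_lin_indepP (fun i => sub_val (x i)) c).1
    (And3 cx (fun i vx0 => x0 i (val_inj (vx0 : val (x i) = val 0)))
      (fun a fa ea s0 => xindep a fa ea (val_inj (etrans (val_sum a fa) s0)))).
  by apply/gr_simple_sequenceP; exists c.
apply/seteqP; split=> [_ [a [fa ->]]|y Ny].
  by rewrite -val_sum //; apply: gs_predP; exact: sub_valP.
have [a [fa yE]] : Defs.span x (SubSort (gs_memP Ny)) by rewrite xT.
by exists a; split=> //; rewrite -val_sum // -yE.
Qed.

End PfmRings.

Local Close Scope ring_scope.

Theorem proposition7p7 (G : groupoid) (R : grRing G) (hR : pfm_ring R)
    (M : grModule R) :
  [/\ (exists (I : choiceType) (x : I -> M), gr_simple_pseudo_basis x),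
      (forall (I J : choiceType) (x : I -> M) (y : J -> M),
         gr_simple_pseudo_basis x -> gr_simple_pseudo_basis y ->
         [set: I] #= [set: J] /\ [set: I] #= [set: sdim M]),
      (forall (I : choiceType) (x : I -> M), gr_simple_sequence x ->
         exists (J : choiceType) (y : J -> M) (f : I -> J),
           [/\ gr_simple_pseudo_basis y, injective f &
               forall i, y (f i) = x i]) &
      (forall N : grSubmodule M,
         [set: (spdim (subGrModule N) + spdim (quoGrModule N))%type]
         #= [set: spdim M])].
Proof.
split.
- exact: exists_gr_simple_pseudo_basis.
- move=> I J x y xb yb; split; first exact: basis_card xb yb.
  have [S Sd] := sdim_decomposition hR M.
  exact: decomposition_card (basis_decomposition xb) Sd.
- exact: extend_gr_simple_sequence.
move=> N.
have [x xb] := spdim_basis hR (subGrModule N).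
have [q qb] := spdim_basis hR (quoGrModule N).
have [z zb] := spdim_basis hR M.
have [xseq xN] := sub_basis_sequence xb.
have [m yb] := extend_basis xseq xN qb.
exact: basis_card yb zb.
Qed.
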